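(* Let $N\ge1$, $p\ge2$, $w,g\in L^1_{loc}(\mathbb{R}^N)$ positive a.e. with $g^{-1}\in L^\infty(\mathbb{R}^N)$. Let $\delta=\gamma\ge1$ with $(\delta,p)$ in the class $P_a$. Let $u\in C^1(\mathbb{R}^N)$, $u>0$, be a stable weak solution of $\operatorname{div}(w|\nabla u|^{p-2}\nabla u)=g(x)(u^{-\delta}+u^{-\gamma})$ (i.e. $=2g(x)u^{-\delta}$) in $\mathbb{R}^N$. Then for every $\beta\in(0,s_p)$ there exists a constant $c>0$, depending on $\beta,p,\delta,m$ but not on $\psi$, such that for every $\psi\in C^1_c(\mathbb{R}^N)$ with $0\le\psi\le1$, $$\int_{\mathbb{R}^N} g\Big(\frac{\psi}{u}\Big)^{2\beta+p-1+\delta}dx\le c\int_{\mathbb{R}^N} w^{\theta_a'}|\nabla\psi|^{p\theta_a'}dx,\qquad \theta_a'=\frac{2\beta+p-1+\delta}{p-1+\delta}.$$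
   Context: Here $m=\|g^{-1}\|_{L^\infty}$. Weak solution and stability are with respect to $f(t)=-t^{-\delta}-t^{-\gamma}$ and the equation $-\operatorname{div}(w|\nabla u|^{p-2}\nabla u)=gf(u)$: $u\in C^1$ is a weak solution if $\int w|\nabla u|^{p-2}\nabla u\cdot\nabla\varphi=\int gf(u)\varphi$ for all $\varphi\in C^1_c(\mathbb{R}^N)$; it is stable if for all $\varphi\in C^1_c(\mathbb{R}^N)$, $\int w|\nabla u|^{p-2}|\nabla\varphi|^2+(p-2)\int w|\nabla u|^{p-4}(\nabla u\cdot\nabla\varphi)^2-\int gf'(u)\varphi^2\ge0$ (middle integrand $=0$ where $\nabla u=0$). Class $P_a$: $(\delta,p)\in P_a$ if either $2\le p<3$ and $\delta\ge1$, or $p=3$ and $\delta>1$, or $p>3$ and $\delta>\frac{(p-1)^2}{4}$. $s_p=\delta+\sqrt{\delta^2+\delta}$ if $p=2$, $s_p=\frac{2\delta}{p-1}-\frac{p-1}{2}$ if $p>2$. *)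

(* Defs.v *)
From HB Require Import structures.
From mathcomp Require Import all_boot all_order all_algebra.
From mathcomp Require Import all_classical all_reals all_analysis ess_sup_inf.
Set Implicit Arguments. Unset Strict Implicit. Unset Printing Implicit Defensive.
Import Order.TTheory GRing.Theory Num.Theory.
Import numFieldNormedType.Exports.
Local Open Scope classical_set_scope.
Local Open Scope ring_scope.

(* R^N is represented by row vectors 'rV[R]_N (normed module, so that  *)
(* differentials are available).  We equip it with the product Borel   *)
(* sigma-algebra generated by the coordinate maps (= Borel sets of R^N).*)

Definition rV_measure_display : measure_display -> measure_display.
Proof. exact. Qed.

Section measurable_rV.
Variable (R : realType) (N : nat).

Let coord : 'I_N -> 'rV[R]_N -> R := fun i x => x ord0 i.

Let rV_set0 : g_sigma_preimage coord set0.
Proof. exact: sigma_algebra0. Qed.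

Let rV_setC A : g_sigma_preimage coord A -> g_sigma_preimage coord (~` A).
Proof. exact: sigma_algebraC. Qed.

Let rV_bigcup (F : _^nat) : (forall i, g_sigma_preimage coord (F i)) ->
  g_sigma_preimage coord (\bigcup_i (F i)).
Proof. exact: sigma_algebra_bigcup. Qed.

HB.instance Definition _ :=
  @isMeasurable.Build (rV_measure_display default_measure_display)
  'rV[R]_N (g_sigma_preimage coord) rV_set0 rV_setC rV_bigcup.

End measurable_rV.

Section defs.
Variable (R : realType).
Local Open Scope ereal_scope.

(* mu is the N-dimensional Lebesgue measure (on Borel sets): it gives    *)
(* every closed box its volume; this characterizes it uniquely.         *)
Definition is_lebesgue (N : nat) (mu : {measure set 'rV[R]_N -> \bar R}) :=
  forall a b : 'rV[R]_N, (forall i, (a ord0 i <= b ord0 i)%R) ->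
    mu [set x | forall i, (a ord0 i <= x ord0 i <= b ord0 i)%R] =
    (\prod_(i < N) (b ord0 i - a ord0 i))%:E.

Definition L1loc (N : nat) (mu : {measure set 'rV[R]_N -> \bar R})
  (f : 'rV[R]_N -> R) :=
  measurable_fun setT f /\
  forall K : set 'rV[R]_N, compact K -> \int[mu]_(x in K) `|f x|%:E < +oo.

Local Close Scope ereal_scope.

Definition evec (N : nat) (i : 'I_N) : 'rV[R]_N := delta_mx ord0 i.

Definition grad (N : nat) (u : 'rV[R]_N -> R) (x : 'rV[R]_N) : 'rV[R]_N :=
  \row_i ('d u x (evec i)).

Definition dotp (N : nat) (a b : 'rV[R]_N) : R := \sum_i a ord0 i * b ord0 i.
Definition enorm (N : nat) (a : 'rV[R]_N) : R := Num.sqrt (dotp a a).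

Definition C1 (N : nat) (u : 'rV[R]_N -> R) :=
  (forall x, differentiable u x) /\
  (forall i : 'I_N, continuous (fun x => 'd u x (evec i))).

Definition C1c (N : nat) (phi : 'rV[R]_N -> R) :=
  C1 phi /\ compact (closure [set x | phi x != 0]).

Definition fnl (delta gamma t : R) : R := - t `^ (- delta) - t `^ (- gamma).
Definition fnl' (delta gamma t : R) : R :=
  delta * t `^ (- delta - 1) + gamma * t `^ (- gamma - 1).

Local Open Scope ereal_scope.

Definition weak_solution (N : nat) (mu : {measure set 'rV[R]_N -> \bar R})
  (p delta gamma : R) (w g u : 'rV[R]_N -> R) :=
  forall phi, C1c phi ->
    \int[mu]_x (w x * enorm (grad u x) `^ (p - 2)
                  * dotp (grad u x) (grad phi x))%:E
    = \int[mu]_x (g x * fnl delta gamma (u x) * phi x)%:E.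

Definition stable (N : nat) (mu : {measure set 'rV[R]_N -> \bar R})
  (p delta gamma : R) (w g u : 'rV[R]_N -> R) :=
  forall phi, C1c phi ->
    0 <= \int[mu]_x (w x * enorm (grad u x) `^ (p - 2)
                       * enorm (grad phi x) ^+ 2)%:E
         + (p - 2)%:E * \int[mu]_x
               (if grad u x == 0 then 0 else
                  w x * enorm (grad u x) `^ (p - 4)
                  * dotp (grad u x) (grad phi x) ^+ 2)%:E
         - \int[mu]_x (g x * fnl' delta gamma (u x) * phi x ^+ 2)%:E.

Local Close Scope ereal_scope.

Definition Pa (delta p : R) : Prop :=
  [/\ 2 <= p, p < 3 & 1 <= delta] \/ (p = 3 /\ 1 < delta)
  \/ (3 < p /\ (p - 1) ^+ 2 / 4 < delta).

Definition s_p (delta p : R) : R :=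
  if p == 2 then delta + Num.sqrt (delta ^+ 2 + delta)
  else 2 * delta / (p - 1) - (p - 1) / 2.

End defs.

(* Main.v *)
(** With [k = beta + (p - 2) / 2] and [q = 2 beta + p - 1 + delta], test the weak
    formulation with [u^-(2k+1) psi^q] and the stability inequality with
    [u^-k psi^(q/2)].  Up to cross terms, this gives for
      [A = int w |grad u|^p u^-(2k+2) psi^q]   and   [G = int g (psi/u)^q]
    the relations [(2k+1) A = 2 G] and [2 delta G <= (p-1) k^2 A]; the condition
    [beta < s_p] makes [(p-1) k^2 < delta (2k+1)], so [G] can be absorbed.  Young's
    inequality moves the cross terms into a small multiple of [A] and a multiple of
    [B = int w (psi/u)^(2 beta) |grad psi|^p], using [psi <= 1] and [delta >= 1].
    A second use of Young's inequality, with [1 <= m g], bounds [B] by a small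
    multiple of [G] and the right-hand side of the theorem. *)

Require Import Defs.
From HB Require Import structures.
From mathcomp Require Import all_boot all_order all_algebra.
From mathcomp Require Import all_classical all_reals all_analysis ess_sup_inf.
From mathcomp Require Import measurable_realfun ring lra.
Import Order.TTheory GRing.Theory Num.Theory.
Import numFieldNormedType.Exports.
Local Open Scope classical_set_scope.
Local Open Scope ring_scope.

(** * Measurability and integrability on R^N *)

Lemma measurable_coord {R : realType} {N : nat} (i : 'I_N) :
  measurable_fun setT (fun x : 'rV[R]_N => x ord0 i).
Proof.
move=> _ B mB; rewrite setTI; apply: sub_sigma_algebra.
case: N i => [[]//|N] i.
rewrite -bigcup_mkord_ord; exists i => //=.
by exists B => //; rewrite setTI inord_val.
Qed.

Lemma measurable_ball_rV {R : realType} {N : nat} (c : 'rV[R]_N) (e : R) :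
  measurable (ball c e).
Proof.
(* The conjunct [0 < e] matters when [N] is 0: the condition on the entries is then vacuous. *)
rewrite (_ : ball c e = \bigcap_(i in [set: 'I_N])
    ((fun x : 'rV[R]_N => x ord0 i) @^-1` ball (c ord0 i) e) `&` [set _ | 0 < e]).
  apply: measurableI; last first.
    by have [->|->] : [set _ : 'rV[R]_N | 0 < e] = setT \/ [set _ : 'rV[R]_N | 0 < e] = set0;
      [case: (0 < e); [left|right]; apply/seteqP; split|exact: measurableT|exact: measurable0].
  apply: fin_bigcap_measurable => [|i _]; first exact: finite_finset.
  rewrite -[X in measurable X]setTI.
  by apply: measurable_coord => //; exact: measurable_ball.
apply/seteqP; split => [x [e0 cx]|x [cx e0]]; first by split => // i _; exact: cx.
by split => // i j; rewrite (ord1 i); exact: cx.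
Qed.

(** [U] is the union of the balls contained in it that have a rational center and radius
    [1 / (n + 1)]; there are countably many of them. *)
Lemma open_measurable_rV {R : realType} {N : nat} (U : set 'rV[R]_N) :
  open U -> measurable U.
Proof.
move=> oU.
pose F (cn : 'rV[rat]_N * nat) : set 'rV[R]_N :=
  let B := ball (map_mx ratr cn.1 : 'rV[R]_N) cn.2.+1%:R^-1 in
  if `[< B `<=` U >] then B else set0.
have -> : U = \bigcup_cn F cn.
  apply/seteqP; split => [x Ux|x [[c n] _]]; last first.
    by rewrite /F /=; case: asboolP => // + Bx; exact.
  have /nbhs_ballP[e /= e0 exU] : nbhs x U by exact: open_nbhs_nbhs.
  (* With a radius below [e / 2], a rational ball containing [x] stays inside [ball x e] by the
     triangle inequality. *)
  have [n _ /(_ n (leqnn n)) ne] := near_infty_natSinv_lt (PosNum (divr_gt0 e0 (ltr0n R 2))).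
  have r0 : 0 < n.+1%:R^-1 :> R by rewrite invr_gt0.
  have /all_sig[c cP] i : {q : rat | ball (x ord0 i) n.+1%:R^-1 (ratr q : R)}.
    apply: cid; have /rat_in_itvoo[q] : x ord0 i < x ord0 i + n.+1%:R^-1 by rewrite ltrDl.
    rewrite inE /= => /andP[q1 q2]; exists q.
    by rewrite -ball_normE /= distrC ger0_norm ?subr_ge0 1?ltW// ltrBlDl.
  exists (\row_i c i, n) => //; rewrite /F/=.
  have cx : ball (map_mx ratr (\row_i c i) : 'rV[R]_N) n.+1%:R^-1 x.
    by split => // i j; rewrite !mxE (ord1 i); apply: ball_sym; exact: cP.
  case: asboolP => // -[] y cy; apply: exU.
  rewrite (splitr e); apply: (ball_triangle (y := map_mx ratr (\row_i c i) : 'rV[R]_N)).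
    by apply: (le_ball (ltW ne)); exact: ball_sym.
  exact: (le_ball (ltW ne)).
apply: countable_bigcupT_measurable => [|cn]; first exact: countableP.
by rewrite /F; case: ifP => _; [exact: measurable_ball_rV|exact: measurable0].
Qed.

Lemma continuous_measurable_rV {R : realType} {N : nat} (f : 'rV[R]_N -> R) :
  continuous f -> measurable_fun setT f.
Proof.
move=> /continuousP cf; apply: (measurability _ (RGenOpens.measurableE R)).
move=> _ [_ [a [b ->]] <-]; rewrite setTI; apply: open_measurable_rV.
exact/cf/interval_open.
Qed.

Lemma compact_measurable_rV {R : realType} {N : nat} (K : set 'rV[R]_N) :
  compact K -> measurable K.
Proof.
move=> cK; rewrite -(setCK K); apply: measurableC; apply: open_measurable_rV.
by rewrite openC; apply: compact_closed => //; exact: norm_hausdorff.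
Qed.

(** On [K] the continuous factor is bounded and [w] is integrable; off [K] the product vanishes. *)
Lemma L1loc_integrableM {R : realType} {N : nat}
    (mu : {measure set 'rV[R]_N -> \bar R}) (w h : 'rV[R]_N -> R) (K : set 'rV[R]_N) :
  L1loc mu w -> continuous h -> compact K -> (forall x, ~ K x -> h x = 0) ->
  mu.-integrable setT (EFin \o (fun x => w x * h x)).
Proof.
move=> [mw lw] ch cK hK0.
have mK := compact_measurable_rV K cK.
have mh := continuous_measurable_rV _ ch.
have wK : mu.-integrable K (EFin \o w).
  apply/integrableP; split; last exact: lw.
  by apply/measurable_EFinP; exact: measurable_funS mw.
rewrite (_ : _ \o _ = (fun x => (w x * h x)%:E) \_ K); last first.
  apply/funext => x /=; rewrite patchE; case: ifPn => //.
  by rewrite notin_setE => /hK0 ->; rewrite mulr0.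
apply/(integrable_mkcond _ mK).
apply: (@integrableMl _ _ _ mu K mK (EFin \o w) h) => //.
  exact: measurable_funS mh.
have /compact_bounded : compact (h @` K).
  by apply: continuous_compact => //; exact: continuous_subspaceT.
move=> [M [Mreal hM]]; exists M; split=> // y My x Kx; apply: (hM y My).
by exists x.
Qed.

(** The maximum of [f] and [h] dominates [f] everywhere and has the same integral as [h], being
    almost everywhere equal to it. *)
Lemma ae_le_Rintegral {d} {T : measurableType d} {R : realType}
    (mu : {measure set T -> \bar R}) (f h : T -> R) :
  mu.-integrable setT (EFin \o f) -> mu.-integrable setT (EFin \o h) ->
  {ae mu, forall x, f x <= h x} ->
  \int[mu]_x f x <= \int[mu]_x h x.
Proof.
move=> fi hi fh.
pose k x := Num.max (f x) (h x).
have mf : measurable_fun setT f by apply/measurable_EFinP; exact: measurable_int fi.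
have mh : measurable_fun setT h by apply/measurable_EFinP; exact: measurable_int hi.
have mk : measurable_fun setT k by exact: measurable_maxr.
have kh : (\int[mu]_x (k x)%:E = \int[mu]_x (h x)%:E)%E.
  apply: ae_eq_integral => //; [exact/measurable_EFinP|exact/measurable_EFinP|].
  by apply: filterS fh => x fhx _; rewrite /k max_r.
have ki : mu.-integrable setT (EFin \o k).
  have nfh : mu.-integrable setT (fun x => `|(f x)%:E| + `|(h x)%:E|)%E.
    by apply: integrableD => //; exact: integrable_abse.
  apply: le_integrable nfh => //; first exact/measurable_EFinP.
  move=> x _; rewrite /= lee_fin [leRHS]ger0_norm ?addr_ge0// /k.
  by case: (leP (f x) (h x)) => _; rewrite ?lerDl ?lerDr.
rewrite /Rintegral -kh; apply: le_Rintegral => // x _.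
by rewrite /k le_max lexx.
Qed.

(** * C^1 calculus of powers *)

Lemma near_eq_cvg_at {R : realType} (f h : R -> R) (t : R) :
  (\forall y \near t, f y = h y) -> {for t, continuous h} -> {for t, continuous f}.
Proof.
move=> fh ch; rewrite /prop_for /continuous_at (nbhs_singleton fh).
by apply: cvg_trans ch; apply: near_eq_cvg; apply: filterS fh => y ->.
Qed.

(* [powR] takes the junk value [1] at negative bases, so [t `^ a] is not even
   continuous at [0]; truncating at [0] makes it C^1 for [1 < a]. *)
Definition ppow {R : realType} (a t : R) : R := Num.max t 0 `^ a.

Lemma ppow_ge0E {R : realType} (a t : R) : 0 <= t -> ppow a t = t `^ a.
Proof. by move=> t0; rewrite /ppow max_l. Qed.

Lemma ppow_le0E {R : realType} (a t : R) : a != 0 -> t <= 0 -> ppow a t = 0.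
Proof. by move=> a0 t0; rewrite /ppow max_r// powR0. Qed.

Lemma continuous_ppow {R : realType} (a : R) : 0 < a -> continuous (ppow a).
Proof.
move=> a0 t; have [t0|t0|->] := ltgtP t 0.
- apply: (near_eq_cvg_at _ (cst 0)); last exact: cst_continuous.
  near=> y; rewrite ppow_le0E ?gt_eqF//; apply: ltW; near: y; exact: lt_nbhsl.
- apply: (near_eq_cvg_at _ (fun y => y `^ a)).
    near=> y; rewrite ppow_ge0E//; apply: ltW; near: y; exact: lt_nbhsr.
  apply: differentiable_continuous; apply/derivable1_diffP.
  by apply: derivable_powR; rewrite in_itv/= t0.
- rewrite /prop_for /continuous_at ppow_le0E ?gt_eqF//.
  apply/cvgr0Pnorm_lt => e e0; near=> y.
  rewrite ger0_norm ?powR_ge0//.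
  (* Writing [e] as the [a]-th power of [e^(1/a)] reduces the claim to [y < e^(1/a)]. *)
  rewrite -[ltRHS](powRr1 (ltW e0)) -(mulVf (lt0r_neq0 a0)) powRrM.
  apply: gt0_ltr_powR => //; rewrite ?nnegrE ?powR_ge0// ?le_max ?lexx ?orbT//.
  rewrite gt_max powR_gt0// andbT (le_lt_trans (ler_norm y))//.
  by near: y; apply: (@nbhs0_lt _ R^o); exact: powR_gt0.
Unshelve. all: by end_near. Qed.

Lemma is_derive_ppow {R : realType} (a t : R) : 1 < a ->
  is_derive t 1 (ppow a) (a * ppow (a - 1) t).
Proof.
move=> a1; have a0 : 0 < a := lt_trans ltr01 a1.
have a10 : 0 < a - 1 by rewrite subr_gt0.
have [t0|t0|->] := ltgtP t 0.
- apply: (@near_eq_is_derive _ _ _ (cst 0)).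
    near=> y; rewrite ppow_le0E ?gt_eqF//; apply: ltW; near: y; exact: lt_nbhsl.
  by rewrite ppow_le0E ?gt_eqF 1?ltW// mulr0; exact: is_derive_cst.
- apply: (@near_eq_is_derive _ _ _ (fun y => y `^ a)).
    near=> y; rewrite ppow_ge0E//; apply: ltW; near: y; exact: lt_nbhsr.
  by rewrite ppow_ge0E 1?ltW//; exact: is_derive1_powR.
- rewrite ppow_le0E ?gt_eqF// mulr0.
  (* Away from [h = 0] the difference quotient at the origin equals [ppow (a - 1) h], which tends to
     0 because [1 < a]. *)
  have H : h^-1 *: (ppow a (h *: 1 + 0) - ppow a 0) @[h --> 0^'] --> (0 : R).
    have : ppow (a - 1) h @[h --> 0^'] --> (0 : R).
      have := continuous_ppow (a - 1) a10 0.
      rewrite /continuous_at ppow_le0E ?gt_eqF// => c0.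
      by apply: cvg_trans c0; apply: cvg_app; exact: cvg_within.
    apply: cvg_trans; apply: near_eq_cvg; near=> h.
    have h0 : h != 0 by near: h; exact: nbhs_dnbhs_neq.
    rewrite [h *: 1]mulr1 addr0 [ppow a 0]ppow_le0E ?gt_eqF// subr0.
    have [h0'|h0'] := lerP h 0; first by rewrite !ppow_le0E ?gt_eqF// scaler0.
    rewrite !ppow_ge0E 1?ltW// -(mulr_powRB1 (ltW h0') a0).
    by rewrite scalerA mulVf// scale1r.
  split; last exact: cvg_lim.
  by apply/cvg_ex; exists 0.
Unshelve. all: by end_near. Qed.

(** * Chain and product rules, and the gradient of [u^-s psi^t] *)

Section C1.
Context {R : realType} {N : nat}.
Implicit Types u v : 'rV[R]_N -> R.

Lemma C1_continuous u : C1 u -> continuous u.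
Proof. by move=> [du _] x; exact: differentiable_continuous. Qed.

Lemma diff_comp1 u (F F' : R -> R) x : differentiable u x ->
    is_derive (u x) 1 F (F' (u x)) ->
  differentiable (F \o u) x /\
  (forall e, 'd (F \o u) x e = F' (u x) * 'd u x e).
Proof.
move=> du dF; have dFu : differentiable F (u x).
  by apply/derivable1_diffP; exact: ex_derive.
split=> [|e]; first exact: differentiable_comp.
by rewrite diff_comp// /comp diff1E// derive1E derive_val mulrC.
Qed.

(** Regularity of [F] is asked only along the values of [u], so that negative powers of a positive
    [u] are covered. *)
Lemma C1_comp u (F F' : R -> R) :
  C1 u -> (forall x, is_derive (u x) 1 F (F' (u x))) -> continuous (F' \o u) ->
  C1 (F \o u).
Proof.
move=> [du cu] dF cF'; split=> [x|i].
  by have [] := diff_comp1 _ _ F' _ (du x) (dF x).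
rewrite (_ : (fun x => _) = (F' \o u) \* (fun x => 'd u x (evec R i))).
  by move=> x; apply: continuousM; [exact: cF'|exact: cu].
apply/funext => x; have [_ H] := diff_comp1 _ _ F' _ (du x) (dF x).
exact: H.
Qed.

Lemma grad_comp u (F F' : R -> R) x :
  C1 u -> is_derive (u x) 1 F (F' (u x)) -> grad (F \o u) x = F' (u x) *: grad u x.
Proof.
move=> [du _] dF; apply/rowP => i; have [_ H] := diff_comp1 _ _ F' _ (du x) dF.
by rewrite [LHS]mxE [RHS]mxE [X in _ = _ * X]mxE; exact: H.
Qed.

Lemma C1M u v : C1 u -> C1 v -> C1 (u \* v).
Proof.
move=> Cu Cv; have [du cu] := Cu; have [dv cv] := Cv; split=> [x|i].
  exact: differentiableM.
rewrite (_ : (fun x => _) = (u \* (fun x => 'd v x (evec R i))) \+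
                            (v \* (fun x => 'd u x (evec R i)))).
  move=> x; have ux := C1_continuous u Cu x; have vx := C1_continuous v Cv x.
  exact: continuousD (continuousM ux (cv i x)) (continuousM vx (cu i x)).
apply/funext => x; have H := @diffM _ _ u v x (du x) (dv x).
exact: (congr1 (fun f => f (evec R i)) H).
Qed.

Lemma gradM u v x : C1 u -> C1 v -> grad (u \* v) x = u x *: grad v x + v x *: grad u x.
Proof.
move=> [du _] [dv _]; apply/rowP => i.
have H := @diffM _ _ u v x (du x) (dv x).
rewrite [LHS]mxE [RHS]mxE [X in _ = X + _]mxE [X in _ = _ + X]mxE.
rewrite [X in _ = _ * X + _]mxE [X in _ = _ + _ * X]mxE.
exact: (congr1 (fun f => f (evec R i)) H).
Qed.

Lemma C1_powR u a : C1 u -> (forall x, 0 < u x) -> C1 (fun x => u x `^ a).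
Proof.
move=> Cu u0; have dF x : is_derive (u x) 1 (fun t => t `^ a) (a * u x `^ (a - 1)).
  exact: is_derive1_powR.
apply: (C1_comp u (fun t => t `^ a) (fun t => a * t `^ (a - 1)) Cu dF) => x.
 apply: (@continuous_comp _ _ _ u (fun t => a * t `^ (a - 1))).
  exact: C1_continuous.
apply: continuousM; first exact: cst_continuous.
apply: differentiable_continuous; apply/derivable1_diffP.
by apply: derivable_powR; rewrite in_itv/= u0.
Qed.

Lemma grad_powR u a x : C1 u -> (forall x, 0 < u x) ->
  grad (fun x => u x `^ a) x = (a * u x `^ (a - 1)) *: grad u x.
Proof.
move=> Cu u0; apply: (grad_comp u (fun t => t `^ a) (fun t => a * t `^ (a - 1))) => //.
exact: is_derive1_powR.
Qed.

Lemma ppowE u a : (forall x, 0 <= u x) -> (fun x => u x `^ a) = ppow a \o u.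
Proof. by move=> u0; apply/funext => x; rewrite /= ppow_ge0E. Qed.

Lemma C1_powR_nneg u a : 1 < a -> C1 u -> (forall x, 0 <= u x) ->
  C1 (fun x => u x `^ a).
Proof.
move=> a1 Cu u0; rewrite (ppowE u a u0).
apply: (C1_comp u (ppow a) (fun t => a * ppow (a - 1) t) Cu
  (fun x => is_derive_ppow a (u x) a1)) => x.
apply: (@continuous_comp _ _ _ u (fun t => a * ppow (a - 1) t)).
  exact: C1_continuous.
apply: continuousM; first exact: cst_continuous.
by apply: continuous_ppow; rewrite subr_gt0.
Qed.

Lemma grad_powR_nneg u a x : 1 < a -> C1 u -> (forall x, 0 <= u x) ->
  grad (fun x => u x `^ a) x = (a * u x `^ (a - 1)) *: grad u x.
Proof.
move=> a1 Cu u0; rewrite (ppowE u a u0).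
rewrite -(ppow_ge0E (a - 1) _ (u0 x)).
exact: (grad_comp u (ppow a) (fun t => a * ppow (a - 1) t) x Cu (is_derive_ppow a _ a1)).
Qed.

(** Collects the two terms of the product rule over a common factor, leaving only scalar identities
    to check. *)
Lemma scaler_factor (V : lmodType R) (a b c d k s t : R) (v w : V) :
  a * c = k * t -> b * d = - (k * s) ->
  a *: (c *: v) + b *: (d *: w) = k *: (t *: v - s *: w).
Proof. by move=> ac bd; rewrite scalerBr !scalerA ac bd scaleNr. Qed.

(** Positivity of [u] handles the negative power, [1 < t] makes [psi^t] of class C^1 across the
    zeros of [psi], and the support stays within that of [psi]. *)
Lemma C1c_powR_prod u psi s t : C1 u -> (forall x, 0 < u x) ->
    C1c psi -> (forall x, 0 <= psi x) -> 1 < t ->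
  C1c (fun x => u x `^ (- s) * psi x `^ t).
Proof.
move=> Cu u0 [Cpsi Kpsi] psi0 t1; split.
  by apply: (C1M (fun x => u x `^ (- s)) (fun x => psi x `^ t));
    [exact: C1_powR|exact: C1_powR_nneg].
apply: subclosed_compact Kpsi _; first exact: closed_closure.
apply: closureS => x /=; apply: contra_neq => ->.
by rewrite powR0 ?mulr0// gt_eqF// (lt_trans _ t1).
Qed.

Lemma grad_powR_prod u psi s t x : C1 u -> (forall x, 0 < u x) ->
    C1c psi -> (forall x, 0 <= psi x) -> 1 < t ->
  grad (fun x => u x `^ (- s) * psi x `^ t) x =
  (u x `^ (- s) * psi x `^ (t - 1)) *:
    (t *: grad psi x - (s * (psi x / u x)) *: grad u x).
Proof.
move=> Cu u0 [Cpsi Kpsi] psi0 t1.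
have Gm := gradM _ _ x (C1_powR u (- s) Cu u0) (C1_powR_nneg psi t t1 Cpsi psi0).
have Gp := grad_powR_nneg psi t x t1 Cpsi psi0.
have Gu := grad_powR u (- s) x Cu u0.
apply: etrans Gm _.
apply: etrans (congr2 (fun a b => u x `^ (- s) *: a + psi x `^ t *: b) Gp Gu) _.
have us : u x `^ (- s - 1) = u x `^ (- s) / u x.
  by rewrite powRB ?(gt_eqF (u0 x)) ?implybT// powRr1// ltW.
apply: scaler_factor; first by ring.
by rewrite us -(mulr_powRB1 (psi0 x) (lt_trans ltr01 t1)); ring.
Qed.

End C1.

(** * Pointwise inequalities *)

Lemma eq_ler {R : realType} (x y : R) : x = y -> x <= y.
Proof. by move=> ->. Qed.

(** * The Euclidean inner product and the Cauchy-Schwarz inequality *)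

Section dot_product.
Context {R : realType} {N : nat}.
Implicit Types a b : 'rV[R]_N.

Lemma dotpC a b : dotp a b = dotp b a.
Proof. by apply: eq_bigr => i _; rewrite mulrC. Qed.

Lemma dotpZr k a b : dotp a (k *: b) = k * dotp a b.
Proof. by rewrite /dotp mulr_sumr; apply: eq_bigr => i _; rewrite mxE mulrCA. Qed.

Lemma dotpBr a b b' : dotp a (b - b') = dotp a b - dotp a b'.
Proof. by rewrite /dotp -sumrB; apply: eq_bigr => i _; rewrite !mxE mulrBr. Qed.

Lemma dotpp_ge0 a : 0 <= dotp a a.
Proof. by apply: sumr_ge0 => i _; rewrite -expr2 sqr_ge0. Qed.

Lemma enorm_ge0 a : 0 <= enorm a.
Proof. exact: sqrtr_ge0. Qed.

Lemma enorm_sqr a : enorm a ^+ 2 = dotp a a.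
Proof. by rewrite sqr_sqrtr// dotpp_ge0. Qed.

Lemma enorm_eq0 a : (enorm a == 0) = (a == 0).
Proof.
apply/idP/eqP => [|->].
  rewrite -sqrf_eq0 enorm_sqr /dotp psumr_eq0; last by move=> i _; rewrite -expr2 sqr_ge0.
  move=> /allP a0; apply/rowP => i; rewrite mxE.
  by have := a0 i (mem_index_enum i); rewrite -expr2 sqrf_eq0 => /eqP.
by rewrite -sqrf_eq0 enorm_sqr /dotp big1// => i _; rewrite mxE mul0r.
Qed.

Lemma enormB_sqr s t a b : enorm (s *: a - t *: b) ^+ 2 =
  s ^+ 2 * enorm a ^+ 2 - 2 * s * t * dotp a b + t ^+ 2 * enorm b ^+ 2.
Proof.
by rewrite !enorm_sqr dotpBr !dotpZr ![dotp (_ - _) _]dotpC !dotpBr !dotpZr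
  (dotpC b a); ring.
Qed.

(** For [b != 0], expand the square of the norm of [|b|^2 a - (a . b) b] and divide by [|b|^2]. *)
Lemma dotp_sqr_le a b : dotp a b ^+ 2 <= enorm a ^+ 2 * enorm b ^+ 2.
Proof.
have [b0|b0] := eqVneq b 0.
  have -> : dotp a b = 0 by rewrite b0 /dotp big1// => i _; rewrite mxE mulr0.
  by rewrite expr0n mulr_ge0 ?sqr_ge0.
have := sqr_ge0 (enorm (enorm b ^+ 2 *: a - dotp a b *: b)).
rewrite enormB_sqr.
have b1 : 0 < enorm b ^+ 2 by rewrite exprn_gt0// lt0r enorm_eq0 b0 enorm_ge0.
rewrite (_ : _ + _ = enorm b ^+ 2 * (enorm a ^+ 2 * enorm b ^+ 2 - dotp a b ^+ 2)); last by ring.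
by rewrite pmulr_rge0// subr_ge0.
Qed.

Lemma normr_dotp_le a b : `|dotp a b| <= enorm a * enorm b.
Proof.
rewrite -(@ler_pXn2r _ 2)// ?nnegrE ?mulr_ge0 ?enorm_ge0//.
by rewrite exprMn real_normK ?num_real// dotp_sqr_le.
Qed.

Lemma enormZ_sqr c a : enorm (c *: a) ^+ 2 = c ^+ 2 * enorm a ^+ 2.
Proof. by rewrite !enorm_sqr dotpZr dotpC dotpZr; ring. Qed.

Lemma dotp0l a b : a = 0 -> dotp a b = 0.
Proof. by move=> ->; apply: big1 => i _; rewrite mxE mul0r. Qed.

End dot_product.

(** * Young-type inequalities and the algebra of the absorption *)

Section pointwise.
Context {R : realType}.
Implicit Types p delta beta s r : R.

Lemma powR_div (x y a : R) : 0 <= x -> 0 < y -> (x / y) `^ a = x `^ a * y `^ (- a).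
Proof.
move=> x0 y0; have y1 : y^-1 = y `^ (-1) by rewrite powR_inv1// ltW.
by rewrite powRM// ?invr_ge0 1?ltW// y1 -powRrM mulN1r.
Qed.

(** Base 0 is allowed: [a] and [b] are not both 0, so both sides vanish there. *)
Lemma powRD_gt0 (x a b : R) : 0 < a + b -> x `^ (a + b) = x `^ a * x `^ b.
Proof. by move=> ab; rewrite powRD// gt_eqF. Qed.

Lemma gt0_powRD (x a b : R) : 0 < x -> x `^ (a + b) = x `^ a * x `^ b.
Proof. by move=> x0; rewrite powRD// (gt_eqF x0) implybT. Qed.

(** Compare [B] with [e V^r]. If [B] is smaller, the first term alone suffices; otherwise
    [V^s <= (B/e)^(s/r)] and the second one does. *)
Lemma powR_young s r e (V B : R) : 0 < s -> 0 < r -> 0 < e -> 0 <= V -> 0 <= B ->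
  V `^ s * B <= e * V `^ (s + r) + e `^ (- (s / r)) * B `^ ((s + r) / r).
Proof.
move=> s0 r0 e0 V0 B0.
have Be : e `^ (- (s / r)) * B `^ ((s + r) / r) = B * (B / e) `^ (s / r).
  have sr0 : 0 < s / r by rewrite divr_gt0.
  have -> : (s + r) / r = 1 + s / r by field; rewrite gt_eqF.
  by rewrite powR_div// (powRD_gt0 _ _ _ (addr_gt0 ltr01 sr0)) powRr1//; ring.
have [BV|VB] := leP B (e * V `^ r).
  rewrite -[leLHS]addr0 lerD ?mulr_ge0 ?powR_ge0//.
  rewrite (powRD_gt0 _ _ _ (addr_gt0 s0 r0)).
  by rewrite mulrCA ler_wpM2l ?powR_ge0.
rewrite Be -[leLHS]add0r lerD ?mulr_ge0 ?powR_ge0 ?(ltW e0)//.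
rewrite mulrC ler_wpM2l//.
have -> : V `^ s = (V `^ r) `^ (s / r) by rewrite -powRrM mulrC divfK ?gt_eqF.
rewrite ge0_ler_powR ?nnegrE ?powR_ge0//.
- by rewrite divr_ge0// ltW.
- by rewrite divr_ge0// ltW.
- by rewrite ler_pdivlMr// mulrC ltW.
Qed.

(* The factor common to the gradient terms of both test functions, where [X]
   stands for [|grad u|]; it equals [V^(2 beta) psi^(delta - 1) (V X)^(p - 2)]
   with [V = psi / u]. *)
Definition weight p delta beta (u psi X : R) : R :=
  u `^ (- (2 * beta + p - 2)) * psi `^ (2 * beta + p - 3 + delta) * X `^ (p - 2).

Lemma weight_ge0 p delta beta u psi X : 0 <= weight p delta beta u psi X.
Proof. by rewrite !mulr_ge0 ?powR_ge0. Qed.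

(** Put [Z = (psi / u) X]. If [Y <= e Z] the first term suffices. Otherwise
    [Z^(p-2) <= (Y/e)^(p-2)], and the weight is at most [(psi/u)^(2 beta) Z^(p-2)], which gives the
    second term. *)
Lemma weight_sqr_le p delta beta e u psi X Y :
    2 <= p -> 1 <= delta -> 0 < beta -> 0 < e ->
    0 < u -> 0 <= psi <= 1 -> 0 <= X -> 0 <= Y ->
  weight p delta beta u psi X * Y ^+ 2 <=
  e ^+ 2 * (weight p delta beta u psi X * (psi / u * X) ^+ 2) +
  e `^ (2 - p) * ((psi / u) `^ (2 * beta) * Y `^ p).
Proof.
move=> p2 d1 b0 e0 u0 /andP[psi0 psi1] X0 Y0.
set P := weight _ _ _ _ _ _; have P0 : 0 <= P by exact: weight_ge0.
have rhs0 : 0 <= e `^ (2 - p) * ((psi / u) `^ (2 * beta) * Y `^ p).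
  by rewrite !mulr_ge0 ?powR_ge0.
have Z0 : 0 <= psi / u * X by rewrite mulr_ge0// divr_ge0// ltW.
have [YZ|ZY] := leP Y (e * (psi / u * X)).
  rewrite -[leLHS]addr0 lerD// [e ^+ 2 * _]mulrCA ler_wpM2l// -exprMn.
  by rewrite ler_pXn2r// nnegrE mulr_ge0// (ltW e0).
have {}Y0 : 0 < Y by apply: le_lt_trans ZY; rewrite mulr_ge0// ltW.
rewrite -[leLHS]add0r lerD ?(mulr_ge0 (sqr_ge0 e) (mulr_ge0 P0 (sqr_ge0 _)))//.
have [psi00|psi_neq0] := eqVneq psi 0.
  suff -> : P = 0 by rewrite mul0r.
  by rewrite /P /weight psi00 powR0 ?mulr0 ?mul0r// gt_eqF//; lra.
have {psi_neq0}psi0 : 0 < psi by rewrite lt0r psi_neq0.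
have V0 : 0 < psi / u by rewrite divr_gt0.
(* The surplus factor [psi^(delta - 1)] is at most 1, by [psi <= 1] and [1 <= delta]. *)
have PV : P <= (psi / u) `^ (2 * beta) * (psi / u * X) `^ (p - 2).
  rewrite [X in _ * X]powRM ?(ltW V0)// mulrA ler_wpM2r ?powR_ge0//.
  rewrite -(gt0_powRD _ _ _ V0) (powR_div _ _ _ (ltW psi0) u0).
  rewrite (_ : 2 * beta + (p - 2) = 2 * beta + p - 2); last by ring.
  rewrite mulrC ler_wpM2r ?powR_ge0//; apply: ger_powR; first by rewrite psi0.
  by lra.
have ZY' : (psi / u * X) `^ (p - 2) <= Y `^ (p - 2) * e `^ (2 - p).
  rewrite -[2 - p]opprB -(powR_div _ _ _ (ltW Y0) e0) ge0_ler_powR//.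
  - by rewrite subr_ge0.
  - by rewrite nnegrE divr_ge0// ltW.
  - by rewrite ler_pdivlMr// mulrC ltW.
have -> : e `^ (2 - p) * ((psi / u) `^ (2 * beta) * Y `^ p) =
    (psi / u) `^ (2 * beta) * (Y `^ (p - 2) * e `^ (2 - p)) * Y ^+ 2.
  have -> : Y `^ p = Y `^ (p - 2) * Y ^+ 2.
    by rewrite -(powR_mulrn 2 (ltW Y0)) -gt0_powRD// subrK.
  by ring.
rewrite ler_wpM2r ?sqr_ge0//; apply: le_trans PV _.
by rewrite ler_wpM2l ?powR_ge0.
Qed.

Lemma weight_quad_le p delta beta a b eta :
    2 <= p -> 1 <= delta -> 0 < beta -> 0 <= b -> 0 < eta ->
  exists2 C, 0 < C & forall u psi X Y,
    0 < u -> 0 <= psi <= 1 -> 0 <= X -> 0 <= Y ->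
    weight p delta beta u psi X * (2 * a * (psi / u * X) * Y + b * Y ^+ 2) <=
    eta * (weight p delta beta u psi X * (psi / u * X) ^+ 2) +
    C * ((psi / u) `^ (2 * beta) * Y `^ p).
Proof.
move=> p2 d1 b0 bge0 eta0.
(* Completing the square turns the cross term into [eta/2 Z^2 + (2 a^2 / eta) Y^2]; the summand 1
   keeps [K] positive. The choice of [e] below gives [K e^2 = eta / 2], so the two halves add up to
   [eta]. *)
pose K := 2 * a ^+ 2 / eta + b + 1.
have K0 : 0 < K by rewrite ltr_wpDl// addr_ge0// divr_ge0 ?(ltW eta0)// mulr_ge0 ?sqr_ge0.
pose e := Num.sqrt (eta / 2 / K).
have e0 : 0 < e by rewrite sqrtr_gt0 !divr_gt0.
exists (K * e `^ (2 - p)); first by rewrite mulr_gt0// powR_gt0.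
move=> u psi X Y u0 psi01 X0 Y0.
have := weight_sqr_le _ _ _ _ _ _ _ _ p2 d1 b0 e0 u0 psi01 X0 Y0.
set P := weight _ _ _ _ _ _; set Z := psi / u * X.
have P0 : 0 <= P by exact: weight_ge0.
rewrite [e ^+ 2]sqr_sqrtr; last by rewrite ltW// !divr_gt0.
rewrite -(ler_pM2l K0) => H.
have amgm : 2 * a * Z * Y + b * Y ^+ 2 <= eta / 2 * Z ^+ 2 + K * Y ^+ 2.
  rewrite -subr_ge0.
  have -> : eta / 2 * Z ^+ 2 + K * Y ^+ 2 - (2 * a * Z * Y + b * Y ^+ 2) =
      eta / 2 * (Z - 2 * a / eta * Y) ^+ 2 + Y ^+ 2.
    by rewrite /K; field; rewrite gt_eqF.
  by rewrite addr_ge0 ?sqr_ge0// mulr_ge0 ?sqr_ge0// divr_ge0// ltW.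
apply: le_trans (ler_wpM2l P0 amgm) _.
rewrite mulrDr mulrCA [P * (K * _)]mulrCA.
have -> : eta * (P * Z ^+ 2) = eta / 2 * (P * Z ^+ 2) + K * (eta / 2 / K * (P * Z ^+ 2)).
  by field; rewrite gt_eqF.
by rewrite -addrA lerD2l -[X in _ + X]mulrA -mulrDr.
Qed.

(** For [p = 2], [s_p] is the positive root of [beta^2 = delta (2 beta + 1)]. For [p > 2], with
    [k = beta + (p - 2) / 2], the bound on [beta] reads [(p - 1)(2k + 1) < 4 delta], hence
    [(p - 1)(k + 1/2)^2 < delta (2k + 1)]. *)
Lemma s_p_gap p delta beta : 2 <= p -> 1 <= delta -> 0 < beta < s_p delta p ->
  (p - 1) * (beta + (p - 2) / 2) ^+ 2 < delta * (2 * (beta + (p - 2) / 2) + 1).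
Proof.
move=> p2 d1 /andP[b0]; rewrite /s_p; case: eqP => [->|/eqP p2' bs].
  have d2 : 0 <= delta ^+ 2 + delta by rewrite addr_ge0 ?sqr_ge0//; lra.
  rewrite subrr mul0r addr0; have := sqrtr_ge0 (delta ^+ 2 + delta).
  have := sqr_sqrtr d2; set S := Num.sqrt _ => S2 S0 bs.
  have [db|db] := leP delta beta; last by nra.
  have : (beta - delta) ^+ 2 < S ^+ 2 by rewrite ltr_pXn2r ?nnegrE ?subr_ge0//; lra.
  by rewrite S2; nra.
have {p2'}p2 : 2 < p by rewrite lt_neqAle eq_sym p2'.
have p1 : 0 < p - 1 by lra.
have : (p - 1) * beta < 2 * delta - (p - 1) ^+ 2 / 2.
  rewrite -ltr_pdivlMl//; apply: lt_le_trans bs _.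
  by apply: eq_ler; field; rewrite gt_eqF.
nra.
Qed.

(** Multiply the first inequality by [(p - 1)(k^2 + eta)], the second by [2k + 1 - eta], and add:
    [A] cancels. The coefficient of [G] becomes [2 kappa - 2 eta (delta + p - 1)], and [eta] is
    chosen to make it [kappa]. *)
Lemma gap_absorb p delta k (kappa := delta * (2 * k + 1) - (p - 1) * k ^+ 2)
    (eta := kappa / (2 * (delta + p - 1))) :
  2 <= p -> 1 <= delta -> 0 < k -> 0 < kappa ->
  0 < eta /\ forall C1 C2, 0 < C1 -> 0 < C2 -> exists2 C, 0 < C & forall A B G,
    (2 * k + 1 - eta) * A <= 2 * G + C1 * B ->
    2 * delta * G <= (p - 1) * ((k ^+ 2 + eta) * A + C2 * B) ->
    kappa * G <= C * B.
Proof.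
move=> p2 d1 k0 kap0; have dp : 0 < 2 * (delta + p - 1) by lra.
have eta0 : 0 < eta by rewrite divr_gt0.
have etaE : eta * (2 * (delta + p - 1)) = kappa by rewrite divfK// gt_eqF.
have p1 : 0 < p - 1 by lra.
have D0 : 0 < 2 * k + 1 - eta.
  rewrite subr_gt0 ltr_pdivrMr//.
  have : 0 <= (p - 1) * k ^+ 2 by rewrite mulr_ge0 ?sqr_ge0// ltW.
  by rewrite /kappa; nra.
split=> // C1 C2 C1_gt0 C2_gt0; set D := 2 * k + 1 - eta in D0 *.
have ke : 0 < k ^+ 2 + eta by rewrite ltr_wpDl// sqr_ge0.
exists ((p - 1) * ((k ^+ 2 + eta) * C1 + D * C2)).
  exact: mulr_gt0 p1 (addr_gt0 (mulr_gt0 ke C1_gt0) (mulr_gt0 D0 C2_gt0)).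
move=> A B G H1 H2.
have := ler_wpM2l (ltW (mulr_gt0 p1 ke)) H1.
have := ler_wpM2l (ltW D0) H2.
move=> H3 H4.
have -> : kappa = 2 * (delta * D - (p - 1) * (k ^+ 2 + eta)).
  have : kappa = 2 * kappa - eta * (2 * (delta + p - 1)) by rewrite etaE; ring.
  by move=> ->; rewrite /D /kappa; ring.
rewrite -subr_ge0 in H3; rewrite -subr_ge0 in H4; rewrite -subr_ge0.
apply: le_trans (addr_ge0 H3 H4) _.
by apply: eq_ler; ring.
Qed.

End pointwise.

(** * Pointwise bounds for the integrands produced by the two test functions *)

Section gradient_pointwise.
Context {R : realType}.
Implicit Types p delta beta : R.

Lemma weight_weak p delta beta (u psi X : R) : 2 <= p -> 1 <= delta -> 0 < beta ->
    0 < u -> 0 <= psi ->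
  X `^ (p - 2) * (u `^ (- (2 * beta + p - 1)) * psi `^ (2 * beta + p - 1 + delta - 1)) =
  weight p delta beta u psi X * (psi / u).
Proof.
move=> p2 d1 b0 u0 psi0; rewrite /weight.
have -> : - (2 * beta + p - 1) = - (2 * beta + p - 2) + -1 by ring.
rewrite (gt0_powRD u _ _ u0) powR_inv1 ?(ltW u0)//.
have q0 : 0 < 2 * beta + p - 1 + delta - 1 by lra.
rewrite -(mulr_powRB1 psi0 q0).
have -> : 2 * beta + p - 1 + delta - 1 - 1 = 2 * beta + p - 3 + delta by ring.
by ring.
Qed.

Lemma weight_stable p delta beta (u psi X : R) : 2 <= p -> 1 <= delta -> 0 < beta ->
    0 < u ->
  X `^ (p - 2) * (u `^ (- (beta + (p - 2) / 2)) *
    psi `^ ((2 * beta + p - 1 + delta) / 2 - 1)) ^+ 2 =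
  weight p delta beta u psi X.
Proof.
move=> p2 d1 b0 u0; rewrite /weight.
have -> : - (2 * beta + p - 2) = - (beta + (p - 2) / 2) + - (beta + (p - 2) / 2) by field.
set c := (2 * beta + p - 1 + delta) / 2 - 1.
have -> : 2 * beta + p - 3 + delta = c + c by rewrite /c; field.
have c0 : 0 < c + c by rewrite /c; lra.
by rewrite (gt0_powRD u _ _ u0) (powRD_gt0 psi c c c0); ring.
Qed.

Lemma weak_integrand_le p delta beta eta :
    2 <= p -> 1 <= delta -> 0 < beta -> 0 < eta ->
  exists2 C, 0 < C & forall (N : nat) (a b : 'rV[R]_N) (u psi : R),
    0 < u -> 0 <= psi <= 1 ->
    enorm a `^ (p - 2) * dotp a
      ((u `^ (- (2 * beta + p - 1)) * psi `^ (2 * beta + p - 1 + delta - 1)) *: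
       ((2 * beta + p - 1 + delta) *: b - ((2 * beta + p - 1) * (psi / u)) *: a)) <=
    (eta - (2 * beta + p - 1)) *
      (weight p delta beta u psi (enorm a) * (psi / u * enorm a) ^+ 2) +
    C * ((psi / u) `^ (2 * beta) * enorm b `^ p).
Proof.
move=> p2 d1 b0 eta0; set q := 2 * beta + p - 1 + delta.
have q0 : 0 < q by rewrite /q; lra.
(* The weak form is linear in the gradient of the test function: a cross term with coefficient
   [q = 2 (q / 2)] and no square of [|b|]. *)
have [C C0 HC] := weight_quad_le p delta beta (q / 2) 0 eta p2 d1 b0 (lexx 0) eta0.
exists C => // N a b u psi u0 /andP[psi0 psi1].
rewrite dotpZr dotpBr !dotpZr mulrA weight_weak// -enorm_sqr.
have psi01 : 0 <= psi <= 1 by rewrite psi0.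
have := HC u psi (enorm a) (enorm b) u0 psi01 (enorm_ge0 a) (enorm_ge0 b).
set P := weight _ _ _ _ _ _; have P0 : 0 <= P by exact: weight_ge0.
set V := psi / u; have V0 : 0 <= V by rewrite divr_ge0// ltW.
set B := _ `^ _ * _; move=> H.
have H2 : P * V * (q * dotp a b) <= P * V * (q * (enorm a * enorm b)).
  rewrite ler_wpM2l ?(mulr_ge0 P0 V0)// ler_pM2l//.
  exact: le_trans (ler_norm _) (normr_dotp_le a b).
rewrite -subr_ge0 in H; rewrite -subr_ge0 in H2; rewrite -subr_ge0.
apply: le_trans (addr_ge0 H H2) _.
by apply: eq_ler; field.
Qed.

Lemma stable_integrand_le p delta beta eta :
    2 <= p -> 1 <= delta -> 0 < beta -> 0 < eta ->
  exists2 C, 0 < C & forall (N : nat) (a b : 'rV[R]_N) (u psi : R),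
    0 < u -> 0 <= psi <= 1 ->
    enorm a `^ (p - 2) * enorm
      ((u `^ (- (beta + (p - 2) / 2)) * psi `^ ((2 * beta + p - 1 + delta) / 2 - 1)) *:
       (((2 * beta + p - 1 + delta) / 2) *: b -
        ((beta + (p - 2) / 2) * (psi / u)) *: a)) ^+ 2 <=
    ((beta + (p - 2) / 2) ^+ 2 + eta) *
      (weight p delta beta u psi (enorm a) * (psi / u * enorm a) ^+ 2) +
    C * ((psi / u) `^ (2 * beta) * enorm b `^ p).
Proof.
move=> p2 d1 b0 eta0; set t := (2 * beta + p - 1 + delta) / 2.
set k := beta + (p - 2) / 2.
have t0 : 0 < t by rewrite /t; lra.
have k0 : 0 < k by rewrite /k; lra.
(* The coefficients are those of the expanded square of [t b - k (psi/u) a]. *)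
have [C C0 HC] := weight_quad_le p delta beta (k * t) (t ^+ 2) eta p2 d1 b0 (sqr_ge0 t) eta0.
exists C => // N a b u psi u0 /andP[psi0 psi1].
rewrite enormZ_sqr mulrA weight_stable// enormB_sqr.
have psi01 : 0 <= psi <= 1 by rewrite psi0.
have := HC u psi (enorm a) (enorm b) u0 psi01 (enorm_ge0 a) (enorm_ge0 b).
set P := weight _ _ _ _ _ _; have P0 : 0 <= P by exact: weight_ge0.
set V := psi / u; have V0 : 0 <= V by rewrite divr_ge0// ltW.
set B := _ `^ _ * _; move=> H.
have H2 : P * (2 * t * k * V * (- dotp b a)) <= P * (2 * t * k * V * (enorm b * enorm a)).
  rewrite ler_wpM2l// ler_wpM2l//; last first.
    by apply: le_trans (ler_norm _) _; rewrite normrN normr_dotp_le.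
  exact: mulr_ge0 (mulr_ge0 (mulr_ge0 (ler0n R 2) (ltW t0)) (ltW k0)) V0.
rewrite -subr_ge0 in H; rewrite -subr_ge0 in H2; rewrite -subr_ge0.
apply: le_trans (addr_ge0 H H2) _.
by apply: eq_ler; ring.
Qed.

(** Cauchy-Schwarz bounds the second gradient term of the stability form by the first. At [a = 0]
    the inner product vanishes, whatever the value of the power [p - 4]. *)
Lemma stable_integrand2_le p (N : nat) (a v : 'rV[R]_N) :
  enorm a `^ (p - 4) * dotp a v ^+ 2 <= enorm a `^ (p - 2) * enorm v ^+ 2.
Proof.
have [a0|a0] := eqVneq a 0.
  by rewrite (dotp0l a v a0) expr0n mulr0 mulr_ge0 ?powR_ge0 ?sqr_ge0.
have X0 : 0 < enorm a by rewrite lt0r enorm_eq0 a0 enorm_ge0.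
have -> : enorm a `^ (p - 2) = enorm a `^ (p - 4) * enorm a ^+ 2.
  rewrite -(powR_mulrn 2 (enorm_ge0 a)) -(gt0_powRD _ _ _ X0).
  by congr (_ `^ _); ring.
by rewrite -mulrA ler_wpM2l ?powR_ge0// dotp_sqr_le.
Qed.

End gradient_pointwise.

(** * Energy estimates *)

Section integral_lemmas.
Context {d} {T : measurableType d} {R : realType}.
Variable mu : {measure set T -> \bar R}.
Implicit Types f h : T -> R.

Lemma EFin_Rintegral f : mu.-integrable setT (EFin \o f) ->
  (\int[mu]_x (f x)%:E)%E = (\int[mu]_x f x)%:E.
Proof. by move=> fi; rewrite fineK//; exact: integrable_fin_num. Qed.

Lemma integrable_lincomb f h a b : mu.-integrable setT (EFin \o f) ->
    mu.-integrable setT (EFin \o h) ->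
  mu.-integrable setT (EFin \o (fun x => a * f x + b * h x)).
Proof.
move=> fi hi.
have := integrableD measurableT (integrableZl measurableT a fi) (integrableZl measurableT b hi).
exact.
Qed.

Lemma Rintegral_lincomb f h a b : mu.-integrable setT (EFin \o f) ->
    mu.-integrable setT (EFin \o h) ->
  \int[mu]_x (a * f x + b * h x) = a * (\int[mu]_x f x) + b * (\int[mu]_x h x).
Proof.
move=> fi hi; rewrite RintegralD//.
- by rewrite !RintegralZl.
- exact: (integrableZl measurableT a fi).
- exact: (integrableZl measurableT b hi).
Qed.

Lemma ae_le_Rintegral_lincomb f h1 h2 a b : mu.-integrable setT (EFin \o f) ->
    mu.-integrable setT (EFin \o h1) -> mu.-integrable setT (EFin \o h2) ->
    {ae mu, forall x, f x <= a * h1 x + b * h2 x} ->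
  \int[mu]_x f x <= a * (\int[mu]_x h1 x) + b * (\int[mu]_x h2 x).
Proof.
move=> fi h1i h2i fh; rewrite -Rintegral_lincomb//.
by apply: ae_le_Rintegral => //; exact: integrable_lincomb.
Qed.

End integral_lemmas.

Lemma continuous_powR_nneg {T : topologicalType} {R : realType} (f : T -> R) (a : R) :
  continuous f -> (forall x, 0 <= f x) -> 0 <= a -> continuous (fun x => f x `^ a).
Proof.
move=> cf f0; rewrite le_eqVlt => /predU1P[<-|a0] x.
  (* Since [0^0 = 1], the power of exponent 0 is constant even at zeros of [f]; this case occurs for
     [p = 2]. *)
  rewrite (_ : (fun _ => _) = cst 1); first exact: cst_continuous.
  by apply/funext => y; rewrite powRr0.
rewrite (_ : (fun _ => _) = ppow a \o f).
  by apply: continuous_comp; [exact: cf|exact: continuous_ppow].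
by apply/funext => y; rewrite /= ppow_ge0E.
Qed.

Section gradient_continuity.
Context {R : realType} {N : nat}.
Implicit Types u v : 'rV[R]_N -> R.

Lemma continuous_dotp_grad u v : C1 u -> C1 v ->
  continuous (fun x => dotp (grad u x) (grad v x)).
Proof.
move=> [_ cu] [_ cv].
rewrite (_ : (fun _ => _) = \sum_i (fun x => 'd u x (evec R i) * 'd v x (evec R i))).
  apply: (big_ind (fun f => continuous f)) => [|f h cf ch x|i _ x].
  - exact: cst_continuous.
  - by apply: continuousD; [exact: cf|exact: ch].
  - exact: continuousM (cu i x) (cv i x).
apply/funext => x; rewrite fct_sumE /dotp.
by apply: eq_bigr => i _; rewrite [X in X * _]mxE [X in _ * X]mxE.
Qed.

Lemma continuous_enorm_grad u : C1 u -> continuous (fun x => enorm (grad u x)).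
Proof.
move=> Cu x; apply: (continuous_comp (f := fun x => dotp (grad u x) (grad u x)));
  [exact: continuous_dotp_grad|exact: sqrt_continuous].
Qed.

Lemma C1_powR_div_continuous u psi a : C1 u -> (forall x, 0 < u x) -> C1 psi ->
  (forall x, 0 <= psi x) -> 0 <= a -> continuous (fun x => (psi x / u x) `^ a).
Proof.
move=> Cu u0 Cpsi psi0 a0; apply: continuous_powR_nneg => // [x|x].
  exact: (continuousM (C1_continuous psi Cpsi x)
    (continuousV (lt0r_neq0 (u0 x)) (C1_continuous u Cu x))).
by rewrite divr_ge0// ltW.
Qed.

End gradient_continuity.

(** Strictness yields [1 < q / 2], so that [psi^(q/2)] is an admissible factor of the test function
    in the stability inequality. *)
Lemma exponent_gt2 {R : realType} (p delta beta : R) :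
  2 <= p -> 1 <= delta -> 0 < beta -> 2 < 2 * beta + p - 1 + delta.
Proof. by move=> *; lra. Qed.

(** * The densities of [A], [B], [G] and the integrability of everything that occurs *)

Section energy.
Context {R : realType} {N : nat}.
Variables (p delta beta : R) (mu : {measure set 'rV[R]_N -> \bar R}).
Variables (w g u psi : 'rV[R]_N -> R).
Hypotheses (p2 : 2 <= p) (d1 : 1 <= delta) (b0 : 0 < beta).
Hypotheses (wL : L1loc mu w) (gL : L1loc mu g).
Hypotheses (Cu : C1 u) (u0 : forall x, 0 < u x).
Hypotheses (Cpsi : C1c psi) (psi01 : forall x, 0 <= psi x <= 1).

Let q := 2 * beta + p - 1 + delta.
Let k := beta + (p - 2) / 2.

(** This density and the next two are the integrands of [A], [B] and [G] without the factors [w] and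
    [g]. *)
Definition gradient_density x := weight p delta beta (u x) (psi x) (enorm (grad u x)) *
  (psi x / u x * enorm (grad u x)) ^+ 2.
Definition cutoff_density x := (psi x / u x) `^ (2 * beta) * enorm (grad psi x) `^ p.
Definition mass_density x := (psi x / u x) `^ q.

Let psi0 x : 0 <= psi x. Proof. by case/andP: (psi01 x). Qed.

Let psi_out x : ~ closure [set y | psi y != 0] x -> psi x = 0.
Proof.
by move=> Kx; apply/eqP/negPn/negP => px; apply: Kx; exact: subset_closure.
Qed.

Let q2 : 2 < q. Proof. exact: exponent_gt2. Qed.
Let q0 : 0 < q. Proof. exact: lt_trans q2. Qed.

Let b2 : 0 < 2 * beta. Proof. exact: mulr_gt0 (ltr0n R 2) b0. Qed.
Let p0 : 0 < p. Proof. exact: lt_le_trans (ltr0n R 2) p2. Qed.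
Let r0 : 0 < 2 * beta + p - 3 + delta.
Proof.
have -> : 2 * beta + p - 3 + delta = q - 2 by rewrite /q; ring.
by rewrite subr_gt0.
Qed.

Let continuous_gradu : continuous (fun x => enorm (grad u x) `^ (p - 2)).
Proof.
apply: continuous_powR_nneg; last by rewrite subr_ge0.
- exact: continuous_enorm_grad.
- by move=> x; exact: enorm_ge0.
Qed.

(** Absorbing [G] later requires it to be finite; the density is continuous and vanishes off the
    support of [psi]. *)
Lemma integrable_mass : mu.-integrable setT (EFin \o (fun x => g x * mass_density x)).
Proof.
apply: (L1loc_integrableM mu g mass_density _ gL _ Cpsi.2).
  exact: (C1_powR_div_continuous u psi q Cu u0 Cpsi.1 psi0 (ltW q0)).
by move=> x Kx; rewrite /mass_density (psi_out x Kx) mul0r powR0 ?mulr0// (gt_eqF q0).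
Qed.

Lemma integrable_cutoff : mu.-integrable setT (EFin \o (fun x => w x * cutoff_density x)).
Proof.
apply: (L1loc_integrableM mu w cutoff_density _ wL _ Cpsi.2) => [x|x Kx].
  have cV := C1_powR_div_continuous u psi _ Cu u0 Cpsi.1 psi0 (ltW b2) x.
  have cY := continuous_powR_nneg _ p (continuous_enorm_grad psi Cpsi.1)
    (fun y => enorm_ge0 (grad psi y)) (ltW p0) x.
  exact: continuousM cV cY.
by rewrite /cutoff_density (psi_out x Kx) mul0r powR0 ?mul0r// (gt_eqF b2).
Qed.

Lemma integrable_gradient :
  mu.-integrable setT (EFin \o (fun x => w x * gradient_density x)).
Proof.
apply: (L1loc_integrableM mu w gradient_density _ wL _ Cpsi.2) => [x|x Kx].
  have cu : continuous (fun x => u x `^ (- (2 * beta + p - 2))).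
    exact: C1_continuous _ (C1_powR u _ Cu u0).
  have cp : continuous (fun x => psi x `^ (2 * beta + p - 3 + delta)).
    exact: continuous_powR_nneg psi _ (C1_continuous psi Cpsi.1) psi0 (ltW r0).
  have cpu : continuous (fun x => psi x / u x).
    move=> y; exact: (continuousM (C1_continuous psi Cpsi.1 y)
      (continuousV (lt0r_neq0 (u0 y)) (C1_continuous u Cu y))).
  have cZ y := continuousM (cpu y) (continuous_enorm_grad u Cu y).
  exact: (continuousM (continuousM (continuousM (cu x) (cp x)) (continuous_gradu x))
    (continuousM (cZ x) (cZ x))).
rewrite /gradient_density /weight (psi_out x Kx) [0 `^ _]powR0 ?(gt_eqF r0)//.
by rewrite mulr0 !mul0r.
Qed.

Section test_function.
Variables (s t : R).
Hypothesis (t1 : 1 < t).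

Definition test_fun x := u x `^ (- s) * psi x `^ t.

Lemma test_fun_C1c : C1c test_fun.
Proof. exact: C1c_powR_prod u psi s t Cu u0 Cpsi psi0 t1. Qed.

Lemma grad_test_fun x : grad test_fun x = (u x `^ (- s) * psi x `^ (t - 1)) *:
  (t *: grad psi x - (s * (psi x / u x)) *: grad u x).
Proof. exact: grad_powR_prod u psi s t x Cu u0 Cpsi psi0 t1. Qed.

Lemma grad_test_fun_out x : ~ closure [set y | psi y != 0] x -> grad test_fun x = 0.
Proof.
move=> Kx; apply: etrans (grad_test_fun x) _.
have -> : u x `^ (- s) * psi x `^ (t - 1) = 0; last exact: scale0r.
by rewrite (psi_out x Kx) powR0 ?mulr0// subr_eq0 (gt_eqF t1).
Qed.

Lemma integrable_weak : mu.-integrable setT (EFin \o (fun x => w x *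
  (enorm (grad u x) `^ (p - 2) * dotp (grad u x) (grad test_fun x)))).
Proof.
apply: (L1loc_integrableM mu w _ _ wL _ Cpsi.2) => [x|x Kx].
  have [Ct _] := test_fun_C1c.
  exact: continuousM (continuous_gradu x) (continuous_dotp_grad u test_fun Cu Ct x).
by rewrite dotpC (dotp0l _ _ (grad_test_fun_out x Kx)) mulr0.
Qed.

Lemma integrable_stable : mu.-integrable setT (EFin \o (fun x => w x *
  (enorm (grad u x) `^ (p - 2) * enorm (grad test_fun x) ^+ 2))).
Proof.
apply: (L1loc_integrableM mu w _ _ wL _ Cpsi.2) => [x|x Kx].
  have [Ct _] := test_fun_C1c.
  have ce := continuous_enorm_grad test_fun Ct x.
  exact: continuousM (continuous_gradu x) (continuousM ce ce).
by rewrite enorm_sqr (dotp0l _ _ (grad_test_fun_out x Kx)) mulr0.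
Qed.

(** For [p < 4] the power of [|grad u|] need not be continuous, so the integrand is only shown to be
    measurable and dominated by that of [integrable_stable]. *)
Lemma integrable_stable2 : mu.-integrable setT (EFin \o (fun x => w x *
  (enorm (grad u x) `^ (p - 4) * dotp (grad u x) (grad test_fun x) ^+ 2))).
Proof.
have [Ct _] := test_fun_C1c.
have md : measurable_fun setT (fun x => dotp (grad u x) (grad test_fun x)).
  exact: continuous_measurable_rV _ (continuous_dotp_grad u test_fun Cu Ct).
have me : measurable_fun setT (fun x => enorm (grad u x)).
  exact: continuous_measurable_rV _ (continuous_enorm_grad u Cu).
apply: (le_integrable measurableT _ _ integrable_stable).
  apply/measurable_EFinP; apply: measurable_funM; first exact: wL.1.
  apply: measurable_funM; last exact: measurable_funX.
  exact: (measurableT_comp (measurable_powR (p - 4)) me).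
move=> x _; rewrite /= lee_fin [leLHS]normrM [leRHS]normrM.
apply: ler_wpM2l; first exact: normr_ge0.
rewrite [leLHS]ger0_norm; last exact: mulr_ge0 (powR_ge0 _ _) (sqr_ge0 _).
rewrite [leRHS]ger0_norm; last exact: mulr_ge0 (powR_ge0 _ _) (sqr_ge0 _).
exact: stable_integrand2_le.
Qed.

End test_function.

(** The exponent of [u] in the test function is fixed by [delta + (2 beta + p - 1) = q]; the factor
    2 comes from the two equal terms of the nonlinearity. *)
Lemma mass_density_weak x :
  g x * fnl delta delta (u x) * test_fun (2 * beta + p - 1) q x =
  - 2 * (g x * mass_density x).
Proof.
rewrite /fnl /test_fun /mass_density (powR_div _ _ _ (psi0 x) (u0 x)).
have -> : - q = - delta + - (2 * beta + p - 1) by rewrite /q; ring.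
by rewrite (gt0_powRD (u x) _ _ (u0 x)); ring.
Qed.

(** Here the exponents balance as [(delta + 1) + 2k = q]. *)
Lemma mass_density_stable x :
  g x * fnl' delta delta (u x) * test_fun k (q / 2) x ^+ 2 =
  2 * delta * (g x * mass_density x).
Proof.
rewrite /fnl' /test_fun /mass_density (powR_div _ _ _ (psi0 x) (u0 x)).
have -> : - q = (- delta - 1) + (- k + - k) by rewrite /q /k; field.
have -> : psi x `^ q = psi x `^ (q / 2) * psi x `^ (q / 2).
  by rewrite -powRD_gt0; [congr (_ `^ _); field|rewrite -splitr].
by rewrite [u x `^ (_ + (- k + - k))](gt0_powRD (u x) _ _ (u0 x))
  (gt0_powRD (u x) (- k) (- k) (u0 x)); ring.
Qed.

End energy.

(** The equation turns the weak form into [-2 G], and integrating [weak_integrand_le] bounds that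
    form from above. The constant is chosen before the measure and the functions, hence is
    independent of [psi]. *)
Lemma weak_energy_le {R : realType} (p delta beta eta : R) :
    2 <= p -> 1 <= delta -> 0 < beta -> 0 < eta ->
  exists2 C, 0 < C & forall (N : nat) (mu : {measure set 'rV[R]_N -> \bar R})
      (w g u psi : 'rV[R]_N -> R),
    L1loc mu w -> L1loc mu g -> {ae mu, forall x, 0 < w x} ->
    C1 u -> (forall x, 0 < u x) -> C1c psi -> (forall x, 0 <= psi x <= 1) ->
    weak_solution mu p delta delta w g u ->
    (2 * (beta + (p - 2) / 2) + 1 - eta) *
      (\int[mu]_x (w x * gradient_density p delta beta u psi x)) <=
    2 * (\int[mu]_x (g x * mass_density p delta beta u psi x)) +
    C * (\int[mu]_x (w x * cutoff_density p beta u psi x)).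
Proof.
move=> p2 d1 b0 eta0.
have [C C0 HC] := weak_integrand_le p delta beta eta p2 d1 b0 eta0.
exists C => // N mu w g u psi wL gL w0 Cu u0 Cpsi psi01 weak.
have q2 := exponent_gt2 p delta beta p2 d1 b0.
set q := 2 * beta + p - 1 + delta in q2 *.
have q1 : 1 < q by apply: lt_trans q2; rewrite ltr1n.
set s := 2 * beta + p - 1.
pose phi := test_fun u psi s q.
have phiC : C1c phi := test_fun_C1c u psi Cu u0 Cpsi psi01 s q q1.
have iw := integrable_weak p mu w u psi p2 wL Cu u0 Cpsi psi01 s q q1.
have ia := integrable_gradient p delta beta mu w u psi p2 d1 b0 wL Cu u0 Cpsi psi01.
have ib := integrable_cutoff p beta mu w u psi p2 b0 wL Cu u0 Cpsi psi01.
have ig := integrable_mass p delta beta mu g u psi p2 d1 b0 gL Cu u0 Cpsi psi01.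
have weakE : \int[mu]_x (w x * (enorm (grad u x) `^ (p - 2) * dotp (grad u x) (grad phi x))) =
    - 2 * (\int[mu]_x (g x * mass_density p delta beta u psi x)).
  rewrite -(RintegralZl (- 2) measurableT ig) /Rintegral; congr fine.
  apply: etrans (etrans (weak phi phiC) _); apply: eq_integral => x _; congr EFin.
    exact: mulrA.
  exact: mass_density_weak.
have H : - 2 * (\int[mu]_x (g x * mass_density p delta beta u psi x)) <=
    (eta - s) * (\int[mu]_x (w x * gradient_density p delta beta u psi x)) +
    C * (\int[mu]_x (w x * cutoff_density p beta u psi x)).
  rewrite -weakE; apply: (ae_le_Rintegral_lincomb mu _ _ _ _ _ iw ia ib).
  apply: filterS w0 => x w0; rewrite [_ * (w x * _)]mulrCA [C * _]mulrCA -mulrDr.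
  apply: ler_wpM2l; first exact: ltW.
  have -> := grad_test_fun u psi Cu u0 Cpsi psi01 s q q1 x.
  exact: HC.
rewrite -subr_ge0 in H; rewrite -subr_ge0; apply: le_trans H _.
by apply: eq_ler; rewrite /s; field.
Qed.

Lemma stable_energy_le {R : realType} (p delta beta eta : R) :
    2 <= p -> 1 <= delta -> 0 < beta -> 0 < eta ->
  exists2 C, 0 < C & forall (N : nat) (mu : {measure set 'rV[R]_N -> \bar R})
      (w g u psi : 'rV[R]_N -> R),
    L1loc mu w -> L1loc mu g -> {ae mu, forall x, 0 < w x} ->
    C1 u -> (forall x, 0 < u x) -> C1c psi -> (forall x, 0 <= psi x <= 1) ->
    stable mu p delta delta w g u ->
    2 * delta * (\int[mu]_x (g x * mass_density p delta beta u psi x)) <=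
    (p - 1) * (((beta + (p - 2) / 2) ^+ 2 + eta) *
      (\int[mu]_x (w x * gradient_density p delta beta u psi x)) +
      C * (\int[mu]_x (w x * cutoff_density p beta u psi x))).
Proof.
move=> p2 d1 b0 eta0.
have [C C0 HC] := stable_integrand_le p delta beta eta p2 d1 b0 eta0.
exists C => // N mu w g u psi wL gL w0 Cu u0 Cpsi psi01 stab.
have q2 := exponent_gt2 p delta beta p2 d1 b0.
set q := 2 * beta + p - 1 + delta in q2 *.
set k := beta + (p - 2) / 2.
have t1 : 1 < q / 2 by rewrite ltr_pdivlMr// mul1r.
pose phi := test_fun u psi k (q / 2).
have phiC : C1c phi := test_fun_C1c u psi Cu u0 Cpsi psi01 k (q / 2) t1.
have i1 := integrable_stable p mu w u psi p2 wL Cu u0 Cpsi psi01 k (q / 2) t1.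
have i2 := integrable_stable2 p mu w u psi p2 wL Cu u0 Cpsi psi01 k (q / 2) t1.
have ia := integrable_gradient p delta beta mu w u psi p2 d1 b0 wL Cu u0 Cpsi psi01.
have ib := integrable_cutoff p beta mu w u psi p2 b0 wL Cu u0 Cpsi psi01.
have ig := integrable_mass p delta beta mu g u psi p2 d1 b0 gL Cu u0 Cpsi psi01.
have ig2 := integrableZl measurableT (2 * delta) ig.
set G := \int[mu]_x (g x * _); set A := \int[mu]_x (w x * gradient_density _ _ _ _ _ _).
set B := \int[mu]_x (w x * _).
pose h1 x := enorm (grad u x) `^ (p - 2) * enorm (grad phi x) ^+ 2.
pose h2 x := enorm (grad u x) `^ (p - 4) * dotp (grad u x) (grad phi x) ^+ 2.
have h1le x : h1 x <= (k ^+ 2 + eta) * gradient_density p delta beta u psi x +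
    C * cutoff_density p beta u psi x.
  rewrite /h1; have -> := grad_test_fun u psi Cu u0 Cpsi psi01 k (q / 2) t1 x.
  exact: HC.
have I1le : \int[mu]_x (w x * h1 x) <= (k ^+ 2 + eta) * A + C * B.
  apply: (ae_le_Rintegral_lincomb mu _ _ _ _ _ i1 ia ib).
  apply: filterS w0 => x w0; rewrite [_ * (w x * _)]mulrCA [C * _]mulrCA -mulrDr.
  exact: ler_wpM2l (ltW w0) _ _ (h1le x).
(* By Cauchy-Schwarz the second gradient integral obeys the same bound as the first; the weights 1
   and [p - 2] then add up to [p - 1]. *)
have I2le : \int[mu]_x (w x * h2 x) <= (k ^+ 2 + eta) * A + C * B.
  apply: (ae_le_Rintegral_lincomb mu _ _ _ _ _ i2 ia ib).
  apply: filterS w0 => x w0; rewrite [_ * (w x * _)]mulrCA [C * _]mulrCA -mulrDr.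
  apply: ler_wpM2l (ltW w0) _ _ (le_trans _ (h1le x)).
  exact: stable_integrand2_le.
have := stab phi phiC.
have -> : (\int[mu]_x (w x * enorm (grad u x) `^ (p - 2) * enorm (grad phi x) ^+ 2)%:E =
    (\int[mu]_x (w x * h1 x)%R)%:E)%E.
  by rewrite -(EFin_Rintegral _ _ i1); apply: eq_integral => x _; rewrite -mulrA.
have -> : (\int[mu]_x (if grad u x == 0 then 0 else
      w x * enorm (grad u x) `^ (p - 4) * dotp (grad u x) (grad phi x) ^+ 2)%:E =
    (\int[mu]_x (w x * h2 x)%R)%:E)%E.
  rewrite -(EFin_Rintegral _ _ i2); apply: eq_integral => x _; congr EFin.
  (* The guard is redundant: the squared product vanishes with [grad u]. *)
  case: eqP => [a0|_]; last by rewrite -mulrA.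
  by rewrite (dotp0l _ _ a0) expr0n !mulr0.
have -> : (\int[mu]_x (g x * fnl' delta delta (u x) * phi x ^+ 2)%:E =
    (2 * delta * G)%:E)%E.
  rewrite -(RintegralZl (2 * delta) measurableT ig) -(EFin_Rintegral _ _ ig2).
  apply: eq_integral => x _; congr EFin; exact: mass_density_stable.
move=> H; have {H} : 0 <= (\int[mu]_x (w x * h1 x)) +
    (p - 2) * (\int[mu]_x (w x * h2 x)) - 2 * delta * G by rewrite -lee_fin.
rewrite subr_ge0 => /le_trans; apply.
have p20 : 0 <= p - 2 by rewrite subr_ge0.
apply: le_trans (lerD I1le (ler_wpM2l p20 I2le)) _.
by apply: eq_ler; ring.
Qed.

(** * Absorption of [G] and conclusion *)

Theorem theorem3p1 (R : realType) (p delta gamma beta m : R) :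
  2 <= p -> gamma = delta -> 1 <= delta -> Pa delta p ->
  0 < beta < s_p delta p ->
  exists c : R, 0 < c /\
  forall (N : nat) (mu : {measure set 'rV[R]_N -> \bar R})
         (w g u : 'rV[R]_N -> R),
    (0 < N)%N -> is_lebesgue mu ->
    L1loc mu w -> L1loc mu g ->
    {ae mu, forall x, 0 < w x} -> {ae mu, forall x, 0 < g x} ->
    ess_sup mu (fun x => ((g x)^-1)%:E) = m%:E ->
    C1 u -> (forall x, 0 < u x) ->
    weak_solution mu p delta gamma w g u ->
    stable mu p delta gamma w g u ->
    forall psi : 'rV[R]_N -> R, C1c psi -> (forall x, 0 <= psi x <= 1) ->
      (\int[mu]_x (g x * (psi x / u x) `^ (2 * beta + p - 1 + delta))%:E
       <= c%:E * \int[mu]_x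
            (w x `^ ((2 * beta + p - 1 + delta) / (p - 1 + delta))
             * enorm (grad psi x)
                 `^ (p * ((2 * beta + p - 1 + delta) / (p - 1 + delta))))%:E)%E.
Proof.
move=> p2 -> d1 _ bs; have [b0 _] := andP bs.
set k := beta + (p - 2) / 2; have k0 : 0 < k by rewrite /k; lra.
set kappa := delta * (2 * k + 1) - (p - 1) * k ^+ 2.
have kappa0 : 0 < kappa by rewrite subr_gt0; exact: s_p_gap.
have [eta0 absorb] := gap_absorb p delta k p2 d1 k0 kappa0.
set eta := kappa / _ in eta0 absorb.
have [Cw Cw0 weakle] := weak_energy_le p delta beta eta p2 d1 b0 eta0.
have [Cs Cs0 stable_le] := stable_energy_le p delta beta eta p2 d1 b0 eta0.
have [C C0 {}absorb] := absorb Cw Cs Cw0 Cs0.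
(* The constant is built before the measure is given, when nothing is known of the sign of [m]; the
   maximum is positive in any case. *)
pose M := Num.max m 1; have M0 : 0 < M by rewrite lt_max ltr01 orbT.
have r0 : 0 < p - 1 + delta by lra.
have bb0 : 0 < 2 * beta by lra.
set r := p - 1 + delta in r0 *.
have qE : 2 * beta + p - 1 + delta = 2 * beta + r by rewrite /r; ring.
(* Chosen so that [C e M = kappa / 2]: after Young's inequality half of [kappa G] survives on the
   left. *)
pose e := kappa / (2 * C * M).
have e0 : 0 < e by rewrite divr_gt0// !mulr_gt0.
pose K := e `^ (- (2 * beta / r)); have K0 : 0 < K by exact: powR_gt0.
have c0 : 0 < 2 * C * K / kappa by rewrite divr_gt0// !mulr_gt0.
exists (2 * C * K / kappa); split=> // N mu w g u _ _ wL gL w0 g0 gm Cu u0 weak stab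
  psi Cpsi psi01.
rewrite qE; set th := (2 * beta + r) / r.
have th0 : 0 < th by rewrite divr_gt0// addr_gt0.
have psi0 x : 0 <= psi x by case/andP: (psi01 x).
have gM : {ae mu, forall x, 1 <= M * g x}.
  have := ess_sup_ge mu (fun x => ((g x)^-1)%:E); rewrite gm.
  apply: filterS2 g0 => x g0; rewrite lee_fin => gm'.
  rewrite -ler_pdivrMr// div1r (le_trans gm')//.
  by rewrite le_max lexx.
pose f x := w x `^ th * enorm (grad psi x) `^ (p * th).
have f0 x : 0 <= f x by rewrite mulr_ge0 ?powR_ge0.
have mf : measurable_fun setT f.
  apply: measurable_funM.
    exact: (measurableT_comp (measurable_powR th) wL.1).
  apply: (measurableT_comp (measurable_powR (p * th))).
  exact: continuous_measurable_rV _ (continuous_enorm_grad psi Cpsi.1).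
have ib := integrable_cutoff p beta mu w u psi p2 b0 wL Cu u0 Cpsi psi01.
have ig := integrable_mass p delta beta mu g u psi p2 d1 b0 gL Cu u0 Cpsi psi01.
(* The right-hand integral may be infinite; the bound is then trivial because [c] is positive. *)
have [foo|foo] := ltP (\int[mu]_x (f x)%:E)%E +oo%E; last first.
  have -> : (\int[mu]_x (f x)%:E = +oo)%E by apply/eqP; rewrite -leye_eq.
  by rewrite gt0_muley ?lte_fin// leey.
have fi : mu.-integrable setT (EFin \o f).
  apply/integrableP; split; first exact/measurable_EFinP.
  by under eq_integral do rewrite /= ger0_norm//.
rewrite (EFin_Rintegral _ _ fi).
have := EFin_Rintegral _ _ ig; rewrite /mass_density qE => ->.
rewrite -EFinM lee_fin.
(* Young's inequality with [V = psi / u], [B = w |grad psi|^p], [s = 2 beta]: the exponents become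
   [s + r = q] and [(s + r) / r = th]. Then [1 <= M g] brings [g] into the [V^q] term. *)
have young : {ae mu, forall x, w x * cutoff_density p beta u psi x <=
    e * M * (g x * mass_density p delta beta u psi x) + K * f x}.
  apply: filterS2 w0 gM => x w0 gM; rewrite /cutoff_density /mass_density qE.
  have V0 : 0 <= psi x / u x by rewrite divr_ge0// ltW.
  have B0 : 0 <= w x * enorm (grad psi x) `^ p by rewrite mulr_ge0 ?powR_ge0// ltW.
  rewrite mulrCA; apply: le_trans (powR_young _ _ e _ _ bb0 r0 e0 V0 B0) _.
  have -> : (w x * enorm (grad psi x) `^ p) `^ th = f x.
    by rewrite powRM ?powR_ge0 ?(ltW w0)// -powRrM.
  rewrite lerD2r -[leRHS]mulrA; apply: ler_wpM2l; first exact: ltW.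
  by rewrite mulrA ler_peMl ?powR_ge0.
have H1 := ae_le_Rintegral_lincomb mu _ _ _ _ _ ib ig fi young.
have H2 := absorb _ _ _ (weakle N mu w g u psi wL gL w0 Cu u0 Cpsi psi01 weak)
  (stable_le N mu w g u psi wL gL w0 Cu u0 Cpsi psi01 stab).
move: H1 H2; rewrite /mass_density qE.
set B := \int[mu]_x (w x * _); set G := \int[mu]_x (g x * _); set F := \int[mu]_x _.
move=> H1 H2.
have H3 : kappa * G <= C * (e * M * G + K * F) by apply: le_trans H2 _; rewrite ler_pM2l.
have eE : C * (e * M * G + K * F) = kappa / 2 * G + C * K * F.
  by rewrite /e; field; rewrite !gt_eqF.
have H4 : kappa / 2 * G <= C * K * F.
  by move: H3; rewrite eE -lerBlDl; apply: le_trans; apply: eq_ler; field.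
have -> : 2 * C * K / kappa * F = (kappa / 2)^-1 * (C * K * F) by field; rewrite gt_eqF.
by rewrite ler_pdivlMl//; exact: divr_gt0 kappa0 (ltr0n R 2).
Qed.
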